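(* Let $F$ be a non-empty bounded subset of $\mathbb{R}^n$. Then the maps $\theta\mapsto\underline{\dim}_{\theta}F$ and $\theta\mapsto\overline{\dim}_{\theta}F$ are continuous for $\theta\in(0,1]$.
   Context: For $U\subset\mathbb{R}^n$, $|U|$ denotes the diameter of $U$. A cover of $F\subset\mathbb{R}^n$ is a finite or countable collection $\{U_i\}$ of subsets of $\mathbb{R}^n$ with $F\subset\bigcup_i U_i$. For non-empty bounded $F\subset\mathbb{R}^n$ and $0<\theta\leq 1$: The lower $\theta$-intermediate dimension $\underline{\dim}_{\theta}F$ is the infimum of those $s\geq 0$ such that for all $\epsilon>0$ and all $\delta_0>0$ there exist $0<\delta\leq\delta_0$ and a cover $\{U_i\}$ of $F$ with $\delta^{1/\theta}\leq|U_i|\leq\delta$ for all $i$ and $\sum_i|U_i|^s\leq\epsilon$. The upper $\theta$-intermediate dimension $\overline{\dim}_{\theta}F$ is the infimum of those $s\geq 0$ such that for all $\epsilon>0$ there exists $\delta_0>0$ such that for all $0<\delta\leq\delta_0$ there is a cover $\{U_i\}$ of $F$ with $\delta^{1/\theta}\leq|U_i|\leq\delta$ for all $i$ and $\sum_i|U_i|^s\leq\epsilon$. *)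

(* Defs.v *)
From HB Require Import structures.
From mathcomp Require Import all_boot all_order all_algebra.
From mathcomp Require Import all_classical all_reals all_analysis.

Set Implicit Arguments.
Unset Strict Implicit.
Unset Printing Implicit Defensive.

Import Order.TTheory GRing.Theory Num.Theory.
Import numFieldNormedType.Exports.

Local Open Scope classical_set_scope.
Local Open Scope ring_scope.

(* The library's norm on 'rV[R]_n is the sup norm; diameters here are
   Euclidean. *)
Definition enorm (R : realType) (n : nat) (x : 'rV[R]_n) : R :=
  Num.sqrt (\sum_(i < n) x ord0 i ^+ 2).

Definition ebounded (R : realType) (n : nat) (F : set 'rV[R]_n) : Prop :=
  exists M : R, forall x, F x -> enorm x <= M.

(* diam set0 = -oo, so the empty set is never admissible in a cover whose
   members have diameter bounded below by a positive number. *)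
Definition diam (R : realType) (n : nat) (U : set 'rV[R]_n) : \bar R :=
  ereal_sup [set (enorm (p.1 - p.2))%:E | p in U `*` U].

(* A finite or countable collection is a family indexed by some D : set nat. *)
Definition is_cover (R : realType) (n : nat) (F : set 'rV[R]_n)
    (D : set nat) (U : nat -> set 'rV[R]_n) : Prop :=
  F `<=` \bigcup_(i in D) U i.

Definition has_theta_cover (R : realType) (n : nat) (F : set 'rV[R]_n)
    (theta s eps delta : R) : Prop :=
  exists (D : set nat) (U : nat -> set 'rV[R]_n),
    [/\ is_cover F D U,
        forall i, D i ->
          ((delta `^ theta^-1)%:E <= diam (U i))%E /\
          (diam (U i) <= delta%:E)%E
      & (\esum_(i in D) (diam (U i) `^ s)%E <= eps%:E)%E].

(* For 0 < n, F bounded and 0 < theta <= 1, the sets whose infimum is taken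
   below contain every s > n and are bounded below by 0, so the real-valued
   inf is the genuine infimum. *)
Definition lower_dim (R : realType) (n : nat) (F : set 'rV[R]_n)
    (theta : R) : R :=
  inf [set s : R | 0 <= s /\
    forall eps delta0 : R, 0 < eps -> 0 < delta0 ->
      exists delta : R, [/\ 0 < delta, delta <= delta0
        & has_theta_cover F theta s eps delta]].

Definition upper_dim (R : realType) (n : nat) (F : set 'rV[R]_n)
    (theta : R) : R :=
  inf [set s : R | 0 <= s /\
    forall eps : R, 0 < eps ->
      exists delta0 : R, 0 < delta0 /\
        forall delta : R, 0 < delta -> delta <= delta0 ->
          has_theta_cover F theta s eps delta].

(* Main.v *)
Require Import Defs.
From mathcomp Require Import all_boot all_order all_algebra.
From mathcomp Require Import all_classical all_reals all_analysis.
From mathcomp Require Import lra.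

Set Implicit Arguments.
Unset Strict Implicit.

Import Order.TTheory GRing.Theory Num.Theory.
Import numFieldNormedType.Exports.

Local Open Scope classical_set_scope.
Local Open Scope ring_scope.

(* Let S(theta) be the set of exponents whose infimum is the dimension.  Since
   delta^(1/theta) increases with theta for delta <= 1, S(phi) is contained in
   S(theta) for theta <= phi.  Conversely (phi/theta) S(theta) is contained in S(phi): in a
   cover at scale delta, replace each U by a closed ball centred in U of
   diameter max(2|U|, r) with r = (2 delta)^(1/phi).  This gives a cover for
   phi at scale 2 delta, and max(2|U|, r) <= 2^(1/phi) |U|^(theta/phi), so the
   sums with exponent s phi/theta are controlled by those with exponent s.
   Hence dim_theta <= dim_phi <= (phi/theta) dim_theta, and continuity on
   (0,1] follows. *)

Lemma esum_leZ (R : realType) (T : choiceType) (I : set T) (c : R)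
    (a b : T -> \bar R) :
  0 <= c -> (forall i, (0 <= a i)%E) ->
  (forall i, I i -> (b i <= c%:E * a i)%E) ->
  (\esum_(i in I) b i <= c%:E * \esum_(i in I) a i)%E.
Proof.
move=> c0 a0 ba; apply: (@le_trans _ _ (\esum_(i in I) (c%:E * a i)%E)%E).
  exact: le_esum.
apply: ge_ereal_sup => _ [X XI <-].
rewrite -ge0_mule_fsumr//; apply: lee_wpmul2l; first by rewrite lee_fin.
by apply: esum_ge; exists X.
Qed.

(** Summing [(a - b)^2 <= 2 a^2 + 2 b^2] over coordinates bounds the squared norm by [4 r^2]; this
    case of the triangle inequality avoids Cauchy-Schwarz. *)
Lemma enormB_le (R : realType) (n : nat) (x y : 'rV[R]_n) (r : R) :
  0 <= r -> enorm x <= r -> enorm y <= r -> enorm (x - y) <= 2 * r.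
Proof.
move=> r0; rewrite /enorm.
have sq0 (z : 'rV[R]_n) : 0 <= \sum_(i < n) z ord0 i ^+ 2.
  by apply: sumr_ge0 => i _; exact: sqr_ge0.
have sqrt_le (z : 'rV[R]_n) (t : R) : 0 <= t ->
    (Num.sqrt (\sum_(i < n) z ord0 i ^+ 2) <= t) =
    (\sum_(i < n) z ord0 i ^+ 2 <= t ^+ 2).
  by move=> t0; rewrite -{1}(ger0_norm t0) -sqrtr_sqr ler_sqrt ?sqr_ge0.
rewrite !sqrt_le ?mulr_ge0// => xr yr.
have /le_trans -> // : \sum_(i < n) (x - y) ord0 i ^+ 2 <=
    2 * (\sum_(i < n) x ord0 i ^+ 2) + 2 * (\sum_(i < n) y ord0 i ^+ 2).
  rewrite !mulr_sumr -big_split/=; apply: ler_sum => i _; rewrite !mxE.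
  by have := sqr_ge0 (x ord0 i + y ord0 i); nra.
by nra.
Qed.

Lemma diam_ge (R : realType) (n : nat) (U : set 'rV[R]_n) (x y : 'rV[R]_n) :
  U x -> U y -> ((enorm (x - y))%:E <= diam U)%E.
Proof. by move=> Ux Uy; apply: ereal_sup_ubound; exists (x, y). Qed.

(** Supplies a centre for the enlarging ball, and the positive dimension without which a ball would
    have diameter 0. *)
Lemma diam_gt0 (R : realType) (n : nat) (U : set 'rV[R]_n) :
  (0 < diam U)%E -> U !=set0 /\ (0 < n)%N.
Proof.
move=> dU; split; last first.
  case: n U dU => // U; rewrite ltNge => /negP; case.
  by apply: ge_ereal_sup => _ [p _ <-]; rewrite /enorm big_ord0 sqrtr0.
apply/set0P/eqP => U0; move: dU; rewrite ltNge => /negP; apply.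
by apply: ge_ereal_sup => _ [[x y] /= [Ux _] <-]; move: Ux; rewrite U0.
Qed.

Lemma diam_ball (R : realType) (n : nat) (x : 'rV[R]_n) (r : R) :
  (0 < n)%N -> 0 <= r ->
  diam [set y | enorm (y - x) <= r] = (2 * r)%:E.
Proof.
case: n x => // n x _ r0; apply/eqP; rewrite eq_le; apply/andP; split.
  apply: ge_ereal_sup => _ [[y z] /= [yr zr] <-].
  rewrite lee_fin (_ : y - z = (y - x) - (z - x)); last by rewrite opprB addrA subrK.
  exact: enormB_le.
have enorm_delta (t : R) : enorm (t *: delta_mx 0 0 : 'rV[R]_n.+1) = `|t|.
  rewrite /enorm (bigD1 ord0)//= big1 => [|i i0].
    by rewrite !mxE !eqxx mulr1 addr0 sqrtr_sqr.
  by rewrite !mxE eqxx (negbTE i0) mulr0 expr0n.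
pose e : 'rV[R]_n.+1 := delta_mx 0 0.
(* The diameter is attained at two antipodal points of the ball. *)
have -> : 2 * r = enorm ((x + r *: e) - (x + (- r) *: e)).
  by rewrite opprD addrACA subrr add0r -scalerBl enorm_delta opprK ger0_norm; lra.
by apply: diam_ge; rewrite /= addrAC subrr add0r enorm_delta ?normrN ger0_norm.
Qed.

Lemma diam_enlarge (R : realType) (n : nat) (U : set 'rV[R]_n) (r : R) :
  (0 < diam U)%E -> (diam U <= r%:E)%E ->
  exists2 V, U `<=` V & diam V = (2 * r)%:E.
Proof.
move=> U0 Ur; have [[x Ux] n0] := diam_gt0 U0.
have r0 : 0 <= r by rewrite -lee_fin (le_trans (ltW U0)).
exists [set y | enorm (y - x) <= r]; last exact: diam_ball.
by move=> y Uy /=; rewrite -lee_fin (le_trans (diam_ge Uy Ux)).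
Qed.

Lemma powR_inv_le (R : realType) (d x y : R) :
  0 < d <= 1 -> 0 < x -> x <= y -> d `^ x^-1 <= d `^ y^-1.
Proof.
move=> d01 x0 xy; apply: ger_powR => //.
by rewrite lef_pV2 ?posrE// (lt_le_trans x0).
Qed.

Lemma has_theta_cover_anti (R : realType) (n : nat) (F : set 'rV[R]_n)
    (theta phi s eps delta : R) :
  0 < theta -> theta <= phi -> 0 < delta <= 1 ->
  has_theta_cover F phi s eps delta -> has_theta_cover F theta s eps delta.
Proof.
move=> t0 tp d01 [D [U [cov bnd sum]]]; exists D, U; split=> // i /bnd[lo hi].
split=> //; apply: le_trans lo; rewrite lee_fin; exact: powR_inv_le.
Qed.

(** For [2 * d], use [2 <= 2^(1/phi)] and [d <= d^(theta/phi)], the latter because [d <= 1] and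
    [theta/phi <= 1]. For the other term, raise [delta^(1/theta) <= d] to the power [theta/phi]. *)
Lemma max_powR_le (R : realType) (theta phi delta d : R) :
  0 < theta -> theta <= phi -> phi <= 1 -> 0 < delta ->
  delta `^ theta^-1 <= d -> d <= 1 ->
  Num.max (2 * d) ((2 * delta) `^ phi^-1) <= 2 `^ phi^-1 * d `^ (theta / phi).
Proof.
move=> t0 tp p1 d0 lo d1.
have p0 : 0 < phi by exact: lt_le_trans tp.
have dd0 : 0 < d by apply: lt_le_trans lo; exact: powR_gt0.
have tp1 : theta / phi <= 1 by rewrite ler_pdivrMr// mul1r.
rewrite ge_max; apply/andP; split.
  apply: ler_pM => //; first exact: ltW.
    rewrite -[X in X <= _](@powRr1 _ 2)//; apply: ler_powR; first lra.
    by rewrite -invr1 lef_pV2 ?posrE.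
  by apply: ger1_powR => //; rewrite dd0.
rewrite powRM ?(ltW d0)//; apply: ler_wpM2l; first exact: powR_ge0.
have -> : delta `^ phi^-1 = (delta `^ theta^-1) `^ (theta / phi).
  by rewrite -powRrM mulrA mulVf ?mul1r ?gt_eqF.
apply: ge0_ler_powR => //; rewrite ?nnegrE ?powR_ge0 ?(ltW dd0)//.
by rewrite divr_ge0 ?ltW.
Qed.

(** The constant is [2^(1/phi)] from [max_powR_le] raised to the new exponent [s * (phi / theta)].
    The condition [2 * delta <= 1] keeps the minimal diameter [r] below the new scale. *)
Lemma has_theta_cover_scale (R : realType) (n : nat) (F : set 'rV[R]_n)
    (theta phi s eps delta : R) :
  0 < theta -> theta <= phi -> phi <= 1 -> 0 <= s ->
  0 < delta -> 2 * delta <= 1 ->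
  has_theta_cover F theta s eps delta ->
  has_theta_cover F phi (s * (phi / theta)) (2 `^ (s / theta) * eps) (2 * delta).
Proof.
move=> t0 tp p1 s0 d0 d1 [D [U [cov bnd sum]]].
have p0 : 0 < phi by exact: lt_le_trans tp.
pose r := (2 * delta) `^ phi^-1.
have r_le : r <= 2 * delta.
  apply: ge1r_powR; first by rewrite mulr_gt0.
  by rewrite -invr1 lef_pV2 ?posrE.
have [V VP] : {V : nat -> set 'rV[R]_n & forall i, D i ->
    U i `<=` V i /\ diam (V i) = (Num.max (2 * fine (diam (U i))) r)%:E}.
  apply: (@choice _ _ (fun i V => D i -> U i `<=` V /\ diam V = _)) => i.
  (* Outside [D] the value is arbitrary. *)
  have [Di|nDi] := pselect (D i); last by exists set0.
  have [lo hi] := bnd _ Di.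
  have U0 : (0 < diam (U i))%E.
    by apply: lt_le_trans lo; rewrite lte_fin powR_gt0.
  have Ufin : diam (U i) \is a fin_num.
    by rewrite fin_real// (lt_trans _ U0) ?ltNyr// (le_lt_trans hi) ?ltry.
  (* The radius [max(|U|, r/2)] is at least [|U|], so the ball contains [U], and doubling it gives
     the diameter [max(2|U|, r)]. *)
  have [|V UV dV] :=
    @diam_enlarge _ _ (U i) (Num.max (fine (diam (U i))) (r / 2)) U0.
    by rewrite -{1}(fineK Ufin) lee_fin le_max lexx.
  by exists V => _; split => //; rewrite dV maxr_pMr// mulrCA divff// mulr1.
have bndR i : D i ->
    exists d, [/\ diam (U i) = d%:E, delta `^ theta^-1 <= d & d <= delta].
  move=> /bnd[]; case: (diam (U i)) => [d|//|//]; rewrite !lee_fin => lo hi.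
  by exists d.
exists D, V; split.
- by move=> x /cov[i Di Ux]; exists i => //; apply: (VP i Di).1.
- move=> i Di; have [_ ->] := VP i Di; have [d [-> /= lo hi]] := bndR i Di.
  by rewrite !lee_fin le_max lexx orbT ge_max r_le ler_pM2l// hi.
- apply: (@le_trans _ _ ((2 `^ (s / theta))%:E *
      \esum_(i in D) (diam (U i) `^ s)%E)%E); last first.
    by rewrite EFinM lee_wpmul2l// lee_fin powR_ge0.
  apply: esum_leZ => [|i|i Di]; [exact: powR_ge0|exact: poweR_ge0|].
  have [_ ->] := VP i Di; have [d [-> /= lo hi]] := bndR i Di.
  rewrite -EFinM lee_fin.
  have d_ge0 : 0 <= d by apply: le_trans lo; exact: powR_ge0.
  have t_ge0 : 0 <= s * (phi / theta) by rewrite mulr_ge0// divr_ge0 ?ltW.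
  have -> : 2 `^ (s / theta) * d `^ s =
      (2 `^ phi^-1 * d `^ (theta / phi)) `^ (s * (phi / theta)).
    rewrite powRM ?powR_ge0// -!powRrM; congr (_ `^ _ * _ `^ _).
      by rewrite mulrCA [phi / theta]mulrC [_^-1 * (_ * _)]mulrCA
        mulVf ?gt_eqF// mulr1.
    by rewrite mulrCA mulf_div [phi * theta]mulrC divff ?mulr1// mulf_neq0 ?gt_eqF.
  apply: ge0_ler_powR => //; rewrite ?nnegrE.
  + by rewrite le_max powR_ge0 orbT.
  + by rewrite mulr_ge0 ?powR_ge0.
  + by apply: max_powR_le => //; lra.
Qed.

(** For [u <= v] the hypotheses give [0 <= f v - f u <= (v - u) / u * f u], and [f u <= f 1], so [f]
    is Lipschitz away from 0. *)
Lemma continuous_monotone_ratio (R : realType) (f : R -> R) :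
  (forall x, 0 <= f x) ->
  (forall x y, 0 < x -> x <= y -> y <= 1 -> f x <= f y) ->
  (forall x y, 0 < x -> x <= y -> y <= 1 -> f y <= y / x * f x) ->
  {within `]0, 1], continuous f}.
Proof.
move=> f0 fle fge; apply/subspace_continuousP => x /=.
rewrite in_itv/= => /andP[x0 x1]; apply/cvgrPdist_le => e e0.
(* Adding 1 makes the bound on [f] strictly positive, so that it can be divided by. *)
pose C := f 1 + 1; have C0 : 0 < C by rewrite ltr_wpDl.
(* The threshold is chosen so that [(v - u) * C <= e * (x / 2) <= e * u]. *)
have lip u v : 0 < u -> u <= v -> v <= 1 -> x / 2 <= u ->
    v - u <= e * x / (2 * C) -> `|f v - f u| <= e.
  move=> u0 uv v1 xu; rewrite ler_pdivlMr ?mulr_gt0// => vu.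
  have fuv := fle _ _ u0 uv v1; rewrite ger0_norm ?subr_ge0//.
  have := fge _ _ u0 uv v1; rewrite mulrAC ler_pdivlMr// => fvu.
  have fu : f u <= C by rewrite ler_wpDr// fle// (le_trans uv).
  have fu0 := f0 u.
  rewrite -(ler_pM2r u0) mulrBl.
  have : (v - u) * f u <= (v - u) * C by rewrite ler_wpM2l// subr_ge0.
  have : e * (x / 2) <= e * u by rewrite ler_pM2l.
  nra.
rewrite near_withinE; near=> y => /=; rewrite in_itv/= => /andP[y0 y1].
have /ler_normlP[? ?] : `|x - y| <= x / 2.
  by near: y; apply: cvgr_dist_le => //; lra.
have /ler_normlP[? ?] : `|x - y| <= e * x / (2 * C).
  by near: y; apply: cvgr_dist_le => //; rewrite divr_gt0 ?mulr_gt0.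
by have [xy|/ltW yx] := leP x y; [rewrite distrC|]; apply: lip => //; lra.
Unshelve. all: by end_near.
Qed.

(* S x may be empty, but then it is so for all x at once, and inf set0 = 0. *)
Lemma inf_continuous_scaling (R : realType) (S : R -> set R) :
  (forall x s, S x s -> 0 <= s) ->
  (forall x y, 0 < x -> x <= y -> y <= 1 -> S y `<=` S x) ->
  (forall x y s, 0 < x -> x <= y -> y <= 1 -> S x s -> S y (s * (y / x))) ->
  {within `]0, 1], continuous (fun x => inf (S x))}.
Proof.
move=> S0 Santi Sscale.
have lb x : has_lbound (S x) by exists 0 => s; exact: S0.
have inf0 x : 0 <= inf (S x).
  have [->|/set0P ne] := eqVneq (S x) set0; first by rewrite inf0.
  by apply: lb_le_inf => // s; exact: S0.
apply: continuous_monotone_ratio => // x y x0 xy y1.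
- have [Sy|/set0P ne] := eqVneq (S y) set0.
    have [->|/set0P[s /(Sscale _ _ _ x0 xy y1)]] := eqVneq (S x) set0.
      by rewrite Sy.
    by rewrite Sy.
  by apply: lb_le_inf => // s Ss; apply: ge_inf => //; exact: (Santi _ y).
- have y0 : 0 < y by exact: lt_le_trans xy.
  have [Sx|/set0P ne] := eqVneq (S x) set0.
    suff -> : S y = set0 by rewrite reals.inf0 mulr_ge0// divr_ge0 ?ltW.
    by rewrite -subset0 -Sx; exact: Santi.
  (* It remains to see that [inf (S y) / (y / x)] is a lower bound of [S x]. *)
  rewrite mulrC -ler_pdivrMr ?divr_gt0//; apply: lb_le_inf => // s Ss.
  by rewrite ler_pdivrMr ?divr_gt0//; apply: ge_inf => //; exact: Sscale.
Qed.

Theorem corollary2p2 (R : realType) (n : nat) (F : set 'rV[R]_n)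
    (F_nonempty : F !=set0) (F_bounded : ebounded F) :
  {within `]0, 1], continuous (fun theta : R => lower_dim F theta)} /\
  {within `]0, 1], continuous (fun theta : R => upper_dim F theta)}.
Proof.
split; apply: inf_continuous_scaling.
- by move=> x s [].
- move=> x y x0 xy y1 s [s0 Ss]; split=> // eps d eps0 d0.
  have [|delta [delta0 +]] := Ss eps (Num.min d 1) eps0.
    by rewrite lt_min d0 ltr01.
  rewrite le_min => /andP[dd d1] cov; exists delta; split=> //.
  by apply: has_theta_cover_anti cov => //; rewrite delta0.
- move=> x y s x0 xy y1 [s0 Ss]; have y0 : 0 < y by exact: lt_le_trans xy.
  split=> [|eps d eps0 d0]; first by rewrite mulr_ge0// divr_ge0 ?ltW.
  have C0 : 0 < 2 `^ (s / x) :> R by exact: powR_gt0.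
  (* Dividing [eps] cancels the constant of [has_theta_cover_scale]; the halved scales ensure
     [2 * delta <= d] and [2 * delta <= 1]. *)
  have [||delta [delta0 +]] := Ss (eps / 2 `^ (s / x)) (Num.min (d / 2) (1 / 2)).
  + by rewrite divr_gt0.
  + by rewrite lt_min !divr_gt0.
  rewrite le_min => /andP[dd d1] cov; exists (2 * delta); split; [lra|lra|].
  rewrite -(divfK (lt0r_neq0 C0) eps) [_ / _ * _]mulrC.
  by apply: has_theta_cover_scale cov => //; lra.
- by move=> x s [].
- move=> x y x0 xy y1 s [s0 Ss]; split=> // eps eps0.
  have [d [d0 cov]] := Ss eps eps0; exists (Num.min d 1).
  split=> [|delta delta0]; first by rewrite lt_min d0 ltr01.
  rewrite le_min => /andP[dd d1].
  by apply: (@has_theta_cover_anti _ _ _ _ y) => //; [rewrite delta0|exact: cov].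
- move=> x y s x0 xy y1 [s0 Ss]; have y0 : 0 < y by exact: lt_le_trans xy.
  split=> [|eps eps0]; first by rewrite mulr_ge0// divr_ge0 ?ltW.
  have C0 : 0 < 2 `^ (s / x) :> R by exact: powR_gt0.
  have [|d [d0 cov]] := Ss (eps / 2 `^ (s / x)); first by rewrite divr_gt0.
  exists (Num.min d 1); split=> [|delta delta0].
    by rewrite lt_min d0 ltr01.
  rewrite le_min => /andP[dd d1].
  (* Here every small scale must be reached, so the cover is taken at [delta / 2] and enlarged to
     scale [delta]. *)
  have -> : delta = 2 * (delta / 2) by lra.
  rewrite -(divfK (lt0r_neq0 C0) eps) [_ / _ * _]mulrC.
  by apply: has_theta_cover_scale => //; [lra|lra|apply: cov; lra].
Qed.
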